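(* For the maximum throughput fair scheduling (MTFS) problem, let $\theta^*>0$ be the optimal max-min throughput, i.e. the maximum of $\min_{v\in\mathcal{W}}h_v^{\mathcal{S}}$ over all feasible unit time schedules $\mathcal{S}$. Then the final max-min throughput $\theta'$ achieved by the EC algorithm (the minimum over $v\in\mathcal{W}$ of the throughput of $v$ in the schedule it outputs) with granularity $t^g\in(0,1]$ satisfies $$\theta'>\frac{2}{3\left[(W+R+1)t^g+1\right]}\,\theta^* .$$
   Context: Network: $G=(\mathcal{V},\mathcal{E})$ is a finite directed graph (at most one link per ordered pair of nodes) whose nodes are one gateway eNB and a set $\mathcal{W}$ of $W\ge1$ base stations (mmBSs). Links go from eNB to mmBSs or between mmBSs; link $e$ has capacity $c_e>0$. The eNB has $R$ RF chains, $1\le R\le W$; each mmBS has one. $\delta(v)$, $\delta^-(v)$, $\delta^+(v)$ denote the sets of links incident to, entering, and leaving $v$. Feasible unit time schedule: a finite sequence of slots of positive lengths summing to $1$, with in each slot a set of active links such that each mmBS is incident to at most one active link and the eNB to at most $R$ active links. The link time $t_e$ is the total time during which $e$ is active, and the throughput of $v\in\mathcal{W}$ is $h_v=\sum_{e\in\delta^-(v)}c_et_e-\sum_{e\in\delta^+(v)}c_et_e$. EC algorithm, step (i): compute the maximum $\theta$ such that there are $t_e\ge0$ ($e\in\mathcal{E}$) and $t'_k\ge 0$, $k=1,\dots,\nu$, $\nu=\lfloor W/2\rfloor$, satisfying $\sum_{e\in\delta^-(v)}c_et_e-\sum_{e\in\delta^+(v)}c_et_e\ge\theta$ for all $v\in\mathcal{W}$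 and (a) $\sum_k t'_k\le1$; (b) $\sum_k k\,t'_k=\sum_{e\text{ between two mmBSs}}t_e$; (c) $\sum_{e\in\delta(\mathrm{eNB})}t_e\le R-\sum_k\max(0,R-W+2k)\,t'_k$; (d) $\sum_{e\in\delta(v)}t_e\le1$ for every mmBS $v$. Then, with this optimal $\theta$ fixed, choose link times satisfying the same constraints and maximizing $\sum_{e\in\delta^+(\mathrm{eNB})}c_et_e$. The links with positive link time are taken to form no directed cycle (cycles are eliminated by shortening link times along them without changing any throughput). EC algorithm, step (ii), with granularity $t^g\in(0,1]$: 1. Remove all links with zero link time. 2. Replace eNB by $R$ copies $\mathrm{eNB}_1,\dots,\mathrm{eNB}_R$; each link $(\mathrm{eNB},v)$ is replaced by the links $(\mathrm{eNB}_k,v)$, $k=1,\dots,R$, each with link time $t_{(\mathrm{eNB},v)}/R$. Call the result $G_v$. 3. Form a multigraph $G_m$ on the nodes of $G_v$ (orientation ignored) by replacing each link $e$ of $G_v$ with $\lceil t_e/t^g\rceil$ parallel edges; all but one are assigned link time $t^g$ and the last one the remaining $t_e-(\lceil t_e/t^g\rceil-1)t^g$. 4. Properly edge-color $G_m$ with the Karloff–Shmoys algorithm, which uses a number $\kappa\le3\lceil\Delta(G_m)/2\rceil$ of colors ($\Delta$ = maximum degree). The links corresponding to edges of the $i$-th color are scheduled in the $i$-th slot of length $t^g$, each for its assigned link time. 5. If the schedule length $\kappa t^g$ exceeds $1$, scale all times by $1/(\kappa t^g)$. *)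

(* Defs.v *)
From HB Require Import structures.
From mathcomp Require Import all_boot all_order all_algebra.
From mathcomp Require Import reals.

Set Implicit Arguments.
Unset Strict Implicit.
Unset Printing Implicit Defensive.

Import Order.TTheory GRing.Theory Num.Theory.
Local Open Scope ring_scope.

(* The nodes are [option mmBS], with [None] the gateway eNB.  Links have their
   head in [mmBS], so that no link enters the eNB; [link_inj] says that there
   is at most one link per ordered pair of nodes. *)
Record network (R : realType) := Network {
  mmBS : finType;
  link : finType;
  src : link -> option mmBS;
  dst : link -> mmBS;
  cap : link -> R;
  nRF : nat;
  mmBS_gt0 : (0 < #|mmBS|)%N;
  nRF_bounds : (1 <= nRF <= #|mmBS|)%N;
  link_inj : injective (fun e => (src e, dst e));
  link_irrefl : forall e, src e != Some (dst e);
  cap_gt0 : forall e, 0 < cap e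
}.

Arguments src {R n} e.
Arguments dst {R n} e.
Arguments cap {R n} e.

Section Definitions.
Variables (R : realType) (N : network R).

Implicit Types (e : link N) (v : mmBS N) (x : option (mmBS N)).
Implicit Types (t : link N -> R).

Definition is_max (P : R -> Prop) (m : R) : Prop :=
  P m /\ forall y, P y -> y <= m.

Definition enters e x : bool := Some (dst e) == x.
Definition leaves e x : bool := src e == x.
Definition incident e x : bool := enters e x || leaves e x.

Definition throughput t v : R :=
  \sum_(e | enters e (Some v)) cap e * t e
  - \sum_(e | leaves e (Some v)) cap e * t e.

Definition is_min_throughput t (theta : R) : Prop :=
  (exists v, throughput t v = theta) /\ (forall v, theta <= throughput t v).

(* A slot is a pair (length, set of active links). *)
Definition schedule := seq (R * {set link N}).

Definition compatible (A : {set link N}) : Prop :=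
  (forall v, (#|[set e in A | incident e (Some v)]| <= 1)%N)
  /\ (#|[set e in A | incident e None]| <= nRF N)%N.

Definition feasible (S : schedule) : Prop :=
  [/\ forall s, s \in S -> 0 < s.1,
      \sum_(s <- S) s.1 = 1
    & forall s, s \in S -> compatible s.2].

Definition link_time (S : schedule) e : R := \sum_(s <- S | e \in s.2) s.1.

Definition MTFS_optimum (theta : R) : Prop :=
  is_max (fun m => exists2 S, feasible S & is_min_throughput (link_time S) m)
         theta.

Definition nu : nat := #|mmBS N|./2.

(* [t' k] is only relevant for 1 <= k <= nu. *)
Record lp_feasible (theta : R) t (t' : nat -> R) : Prop := LpFeasible {
  lp_t_ge0 : forall e, 0 <= t e;
  lp_t'_ge0 : forall k, (1 <= k <= nu)%N -> 0 <= t' k;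
  lp_theta : forall v, theta <= throughput t v;
  lp_a : \sum_(1 <= k < nu.+1) t' k <= 1;
  lp_b : \sum_(1 <= k < nu.+1) k%:R * t' k = \sum_(e | ~~ incident e None) t e;
  lp_c : \sum_(e | incident e None) t e <=
         (nRF N)%:R - \sum_(1 <= k < nu.+1)
           Num.max 0 ((nRF N)%:R - #|mmBS N|%:R + 2 * k%:R) * t' k;
  lp_d : forall v, \sum_(e | incident e (Some v)) t e <= 1
}.

Definition lp_optimum (theta : R) : Prop :=
  is_max (fun th => exists t (t' : nat -> R), lp_feasible th t t') theta.

Definition gateway_rate t : R := \sum_(e | leaves e None) cap e * t e.

Definition lp_link_times t : Prop :=
  exists2 theta, lp_optimum theta &
    (exists t' : nat -> R, lp_feasible theta t t') /\
    (forall (u : link N -> R) (u' : nat -> R), lp_feasible theta u u' ->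
       gateway_rate u <= gateway_rate t).

Definition directed_cycle (p : seq (link N)) : bool :=
  [&& p != [::], cycle (fun e f => enters e (src f)) p
    & uniq [seq dst e | e <- p]].

(* Removing the same rate [r] from each link of a cycle, i.e. the time
   [r / cap e] from link [e], leaves every throughput unchanged. *)
Definition shorten t (p : seq (link N)) (r : R) : link N -> R :=
  fun e => if e \in p then t e - r / cap e else t e.

Inductive eliminate_cycles : (link N -> R) -> (link N -> R) -> Prop :=
| Elim_done t :
    (forall p, directed_cycle p -> ~ (forall e, e \in p -> 0 < t e)) ->
    eliminate_cycles t t
| Elim_step t u p r :
    directed_cycle p -> 0 < r -> (forall e, e \in p -> r / cap e <= t e) ->
    eliminate_cycles (shorten t p r) u ->
    eliminate_cycles t u.

Variables (t : link N -> R) (tg : R).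

(* [inl k] is the copy eNB_k of the eNB. *)
Definition vnode := ('I_(nRF N) + mmBS N)%type.

(* [(e, Some k)] is the copy leaving eNB_k of a link [e] of the eNB, and
   [(e, None)] stands for a link [e] between two mmBSs; the other pairs are
   excluded by [in_Gv]. *)
Definition vlink := (link N * option 'I_(nRF N))%type.

Definition in_Gv (l : vlink) : bool :=
  (t l.1 != 0) && (isSome l.2 == leaves l.1 None).

Definition vincident (l : vlink) (a : vnode) : bool :=
  match a with
  | inl k => l.2 == Some k
  | inr v => incident l.1 (Some v)
  end.

Definition vtime (l : vlink) : R :=
  if l.2 is Some _ then t l.1 / (nRF N)%:R else t l.1.

(* The multiplicity in G_m, set to 0 when [l] is not a link of G_v, so that
   [Gm_edge] is exactly the set of edges of G_m. *)
Definition mult (l : vlink) : nat :=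
  if in_Gv l then `|Num.ceil (vtime l / tg)|%N else 0%N.

Definition Gm_edge := {l : vlink & 'I_(mult l)}.

Definition Gm_incident (m : Gm_edge) (a : vnode) : bool := vincident (tag m) a.

Definition edge_time (m : Gm_edge) : R :=
  let n := mult (tag m) in
  if (tagged m).+1 == n then vtime (tag m) - n.-1%:R * tg else tg.

Definition Gm_degree (a : vnode) : nat := #|[set m | Gm_incident m a]|.
Definition Gm_max_degree : nat := (\max_(a : vnode) Gm_degree a)%N.

Definition proper_coloring (kappa : nat) (color : Gm_edge -> 'I_kappa) : Prop :=
  forall m m' a, m != m' -> Gm_incident m a -> Gm_incident m' a ->
    color m != color m'.

Definition scaling (kappa : nat) : R :=
  if 1 < kappa%:R * tg then (kappa%:R * tg)^-1 else 1.

(* A slot of the computed schedule is a pair (length, active time of each link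
   within the slot), because a link may be active for only part of a slot. *)
Definition timed_schedule := seq (R * (link N -> R)).

Definition color_schedule (kappa : nat) (color : Gm_edge -> 'I_kappa) :
    timed_schedule :=
  [seq (scaling kappa * tg,
        fun e => \sum_(m | (color m == i) && ((tag m).1 == e))
                   scaling kappa * edge_time m)
  | i <- enum 'I_kappa].

Definition timed_link_time (S : timed_schedule) e : R := \sum_(s <- S) s.2 e.

End Definitions.

(* Of the Karloff-Shmoys algorithm only its guarantee is kept: a proper edge
   coloring with at most 3 * ceil(Delta / 2) colors. *)
Definition EC_output (R : realType) (N : network R) (tg : R)
    (S : timed_schedule N) : Prop :=
  exists (t0 t : link N -> R) (kappa : nat)
         (color : Gm_edge t tg -> 'I_kappa),
    [/\ lp_link_times t0,
        eliminate_cycles t0 t,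
        proper_coloring color,
        (kappa <= 3 * uphalf (Gm_max_degree t tg))%N
      & S = color_schedule color].

(* Main.v *)
(* The link times of a feasible schedule satisfy the constraints of the linear
   program (with t'_k the total time of the slots with k active links between
   mmBSs), so its optimum is at least theta_star.  Eliminating cycles preserves
   throughputs, and leaves at most one link between two nodes of G_v; hence a
   node of G_v has at most W + R - 1 neighbors, and rounding up the link times
   gives Delta(G_m) <= 1 / tg + W + R - 1.  The schedule realizes the link times
   up to the scaling factor, which is 1 or 1 / (kappa tg), and
   kappa tg <= 3 (Delta + 1) tg / 2 <= 3 (1 + (W + R) tg) / 2. *)
Require Import Defs.
From mathcomp Require Import all_boot all_order all_algebra.
From mathcomp Require Import reals lra ring zify.

Set Implicit Arguments.
Unset Strict Implicit.
Unset Printing Implicit Defensive.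

Import Order.TTheory GRing.Theory Num.Theory.
Local Open Scope ring_scope.

(** * The linear program as a relaxation of scheduling *)

Section Relaxation.
Variables (R : realType) (N : network R).
Implicit Types (A : {set link N}) (S : schedule N) (e : link N).

Definition inner_links A : {set link N} := [set e in A | ~~ incident e None].

Lemma incident_None e : incident e None = (src e == None).
Proof. by []. Qed.

Lemma card_inner_endpoints e : ~~ incident e None ->
  #|[set v | incident e (Some v)]| = 2%N.
Proof.
rewrite incident_None; case se: (src e) => [u|] // _.
have ne : dst e != u by have := link_irrefl e; rewrite se => /eqP h;
  apply/eqP => h'; apply: h; rewrite h'.
rewrite (_ : [set v | _] = [set dst e; u]) ?cards2 ?ne //.
by apply/setP => v; rewrite !inE /incident /enters /leaves se
  !(inj_eq Some_inj) eq_sym (eq_sym u).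
Qed.

Lemma card_gateway_endpoints e : incident e None ->
  #|[set v | incident e (Some v)]| = 1%N.
Proof.
rewrite incident_None => /eqP se.
rewrite (_ : [set v | _] = [set dst e]) ?cards1 //.
by apply/setP => v; rewrite !inE /incident /enters /leaves se orbF
  (inj_eq Some_inj) eq_sym.
Qed.

(* Double counting of the pairs (mmBS, incident active link): a link between
   mmBSs is counted twice, a link of the eNB once. *)
Lemma compatible_card A : compatible A ->
  ((#|inner_links A|).*2 + #|[set e in A | incident e None]| <= #|mmBS N|)%N.
Proof.
move=> [hA _].
have <- : (\sum_v #|[set e in A | incident e (Some v)]| =
  (#|inner_links A|).*2 + #|[set e in A | incident e None]|)%N.
  under eq_bigr => v _ do rewrite -sum1_card.
  rewrite (exchange_big_dep (fun e => e \in A)) /=; last first.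
    by move=> v e _; rewrite inE => /andP[].
  rewrite (bigID (fun e => ~~ incident e None)) /=; congr addn.
    rewrite -muln2 -sum_nat_const.
    apply: eq_big => [e|e /andP[eA he]]; first by rewrite inE.
    rewrite sum1dep_card -(card_inner_endpoints he).
    by apply: eq_card => v; rewrite !inE eA.
  rewrite -sum1_card.
  apply: eq_big => [e|e /andP[eA /negbNE he]]; first by rewrite inE negbK.
  rewrite sum1dep_card -(card_gateway_endpoints he).
  by apply: eq_card => v; rewrite !inE eA.
rewrite -sum1_card; apply: leq_sum => v _; exact: hA.
Qed.

(** Exchanging the sums over links and slots reduces each constraint of the linear program to one
    about a single slot. *)
Lemma sum_link_time S (P : pred (link N)) :
  \sum_(e | P e) link_time S e =
  \sum_(s <- S) #|[set e in s.2 | P e]|%:R * s.1.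
Proof.
rewrite /link_time (exchange_big_dep predT) //=; apply: eq_bigr => s _.
rewrite (eq_bigl (fun e => e \in [set e in s.2 | P e])) /=; last first.
  by move=> e; rewrite inE andbC.
by rewrite sumr_const mulr_natl.
Qed.

Definition slot_time S (k : nat) : R :=
  \sum_(s <- S | #|inner_links s.2| == k) s.1.

(** A slot counts for exactly one [k], which is at most [nu] by [compatible_card]. Slots with
    [k = 0] fall outside the range of summation, hence the condition on [f]. *)
Lemma sum_slot_time S (f : nat -> R) : f 0%N = 0 ->
  (forall s, s \in S -> compatible s.2) ->
  \sum_(1 <= k < (nu N).+1) f k * slot_time S k =
  \sum_(s <- S) f #|inner_links s.2| * s.1.
Proof.
move=> f0 hS; rewrite /slot_time.
under eq_bigr => k _ do rewrite mulr_sumr big_mkcond /=.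
rewrite exchange_big /= big_seq [RHS]big_seq; apply: eq_bigr => s sS.
have hk : (#|inner_links s.2| <= nu N)%N.
  have := compatible_card (hS _ sS); rewrite /nu; lia.
rewrite -big_mkcond /=.
have [c0|cn0] := eqVneq #|inner_links s.2| 0%N.
  rewrite c0 f0 mul0r big_nat_cond big1 // => k /andP[/andP[k1 _] /eqP k0].
  by rewrite -k0 in k1.
rewrite (eq_bigl (fun k => k == #|inner_links s.2|)); last first.
  by move=> k; rewrite eq_sym.
rewrite big_nat1_eq ifT //; lia.
Qed.

Lemma feasible_lp_feasible S (m : R) : feasible S ->
  (forall v, m <= throughput (link_time S) v) ->
  lp_feasible m (link_time S) (slot_time S).
Proof.
move=> [Spos S1 Scomp] hm.
have Sge0 s : s \in S -> 0 <= s.1 by move/Spos/ltW.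
have sum_le (f g : R * {set link N} -> R) :
    (forall s, s \in S -> f s <= g s) ->
    \sum_(s <- S) f s * s.1 <= \sum_(s <- S) g s * s.1.
  move=> fg; rewrite big_seq [leRHS]big_seq; apply: ler_sum => s sS.
  by rewrite ler_wpM2r ?fg ?Sge0.
split=> //.
- move=> e; rewrite /link_time big_seq_cond sumr_ge0 // => s /andP[sS _].
  exact: Sge0.
- move=> k _; rewrite /slot_time big_seq_cond sumr_ge0 // => s /andP[sS _].
  exact: Sge0.
(* Constraint (a): the indicator of [k != 0] vanishes at 0 and is at most 1 on each slot. *)
- have := @sum_slot_time S (fun k => (k != 0%N)%:R) erefl Scomp.
  rewrite (eq_big_nat _ _ (F2 := fun k => slot_time S k)); last first.
    by move=> [|k] //= _; rewrite mul1r.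
  move=> ->; rewrite -[leRHS]S1 -[leRHS](eq_bigr _ (fun s _ => mul1r s.1)).
  by apply: sum_le => s _; case: (_ == _); rewrite ?ler01.
- rewrite sum_slot_time // sum_link_time.
  by apply: eq_bigr => s _.
- have /andP[_ RW] := nRF_bounds N.
  rewrite sum_link_time.
  (* Constraint (c): the coefficient vanishes at [k = 0] because R <= W. *)
  rewrite (@sum_slot_time S (fun k => Num.max 0
    ((nRF N)%:R - #|mmBS N|%:R + 2 * k%:R))) //; last first.
    by rewrite mulr0 addr0 max_l // subr_le0 ler_nat.
  rewrite -[X in X - _]mulr1 -[X in _ * X - _]S1 mulr_sumr -sumrB.
  under [leRHS]eq_bigr => s _ do rewrite -mulrBl.
  apply: sum_le => s sS.
  (* With [g] eNB links and [k] inner links active, [g <= R] and [2k + g <= W] give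
     [max(0, R - W + 2k) <= R - g]. *)
  have := compatible_card (Scomp s sS).
  have [_] := Scomp s sS.
  move: #|_| #|inner_links _| => g k; rewrite -!(ler_nat R) natrD -mul2n natrM.
  by move=> h1 h2; rewrite lerBrDr addrC -lerBrDr ge_max; apply/andP; split; lra.
- move=> v; rewrite sum_link_time -[leRHS]S1.
  rewrite -[leRHS](eq_bigr _ (fun s _ => mul1r s.1)).
  by apply: sum_le => s sS; rewrite lern1; case: (Scomp s sS).
Qed.

End Relaxation.

(** * Invariants of cycle elimination *)

Section Cycles.
Variables (R : realType) (N : network R).
Implicit Types (t u : link N -> R) (p : seq (link N)).

(** Each source is the head of the preceding link, so the sources are the heads rotated by one
    place. *)
Lemma directed_cycle_perm p : directed_cycle p ->
  perm_eq [seq src e | e <- p] [seq Some (dst e) | e <- p].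
Proof.
case: p => [|x q] // /and3P[_ + _]; rewrite /cycle.
have path_src y s : path (fun e f => enters e (src f)) y s ->
    [seq src e | e <- s] = [seq Some (dst e) | e <- belast y s].
  by elim: s y => //= z s IH y /andP[/eqP -> /IH ->].
move/path_src; rewrite belast_rcons => <-.
by rewrite map_rcons -perm_rcons.
Qed.

Lemma sum_cap_shorten t p (r : R) (P : pred (link N)) : uniq p ->
  \sum_(e | P e) cap e * Defs.shorten t p r e =
  \sum_(e | P e) cap e * t e - (count P p)%:R * r.
Proof.
move=> up; have -> : (count P p)%:R * r = \sum_(e | P e) (e \in p)%:R * r.
  rewrite -mulr_suml -natr_sum; congr (_%:R * _).
  rewrite -sum1_count big_mkcond [RHS]big_mkcond (big_uniq _ up) /=.
  by rewrite big_mkcond; apply: eq_bigr => e _; case: (e \in p); case: (P e).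
rewrite -sumrB; apply: eq_bigr => e _; rewrite /Defs.shorten.
have c0 : cap e != 0 by rewrite gt_eqF ?cap_gt0.
by case: (e \in p); rewrite ?mul1r ?mul0r; [field | ring].
Qed.

(** The cycle enters a node as often as it leaves it, and each passage changes the rate by the same
    [r]. *)
Lemma throughput_shorten t p (r : R) v : directed_cycle p ->
  throughput (Defs.shorten t p r) v = throughput t v.
Proof.
move=> cp; have up : uniq p by case/and3P: cp => _ _ /map_uniq.
rewrite /throughput !sum_cap_shorten //.
have -> : count (fun e => enters e (Some v)) p =
          count (fun e => leaves e (Some v)) p; last by ring.
have := permP (directed_cycle_perm cp) (pred1 (Some v)).
by rewrite !count_map.
Qed.

Lemma eliminate_cycles_spec t u : eliminate_cycles t u ->
  (forall e, 0 <= t e) ->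
  [/\ forall e, 0 <= u e, forall e, u e <= t e,
      forall v, throughput u v = throughput t v
    & forall p, directed_cycle p -> ~ (forall e, e \in p -> 0 < u e)].
Proof.
elim=> {t u} [t noc|t u p r cp r0 hp _ IH] t0; first by split.
have rc e : 0 < r / cap e by rewrite divr_gt0 ?cap_gt0.
have [|u0 ut hth noc] := IH.
  by move=> e; rewrite /Defs.shorten; case: ifP => // /hp; rewrite subr_ge0.
split=> // [e|v]; last by rewrite hth throughput_shorten.
apply: le_trans (ut e) _; rewrite /Defs.shorten; case: ifP => // _.
by rewrite gerBl ltW.
Qed.

End Cycles.

(** * Link times carried by G_m and by the colored schedule *)

Section Coloring.
Variables (R : realType) (N : network R) (t : link N -> R) (tg : R).
Hypothesis t_ge0 : forall e, 0 <= t e.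
Hypothesis tg_gt0 : 0 < tg.
Implicit Types (l : vlink N) (a : vnode N) (e : link N) (v : mmBS N).

Lemma nRF_gt0 : (0 < nRF N)%N.
Proof. by case/andP: (nRF_bounds N). Qed.

Lemma in_Gv_vtime_gt0 l : in_Gv t l -> 0 < vtime t l.
Proof.
case: l => e o /andP[/= te _]; have te0 : 0 < t e by rewrite lt_def te t_ge0.
by case: o => [k|] //=; rewrite /vtime /= divr_gt0 ?ltr0n ?nRF_gt0.
Qed.

Lemma sum_vtime e : \sum_(o | in_Gv t (e, o)) vtime t (e, o) = t e.
Proof.
rewrite /in_Gv /=; have [te|te] := eqVneq (t e) 0; first by rewrite big_pred0.
case le: (leaves e None) => /=; last first.
  by rewrite (big_pred1 None) // => -[].
rewrite (eq_bigl (fun o => o \in predC1 None)); last by case.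
rewrite (eq_bigr (fun=> t e / (nRF N)%:R)); last by case.
rewrite sumr_const cardC1 card_option card_ord /=.
by rewrite -[_ *+ _]mulr_natr divfK // pnatr_eq0 -lt0n nRF_gt0.
Qed.

Lemma mult_bound l : in_Gv t l ->
  (0 < mult t tg l)%N /\ (mult t tg l)%:R < vtime t l / tg + 1.
Proof.
move=> lG; have q0 : 0 < vtime t l / tg by rewrite divr_gt0 ?in_Gv_vtime_gt0.
rewrite /mult lG; have c0 : 0 < Num.ceil (vtime t l / tg) by rewrite ceil_gt0.
split; first by rewrite absz_gt0 gt_eqF.
rewrite natr_absz gtr0_norm // -ltrBlDr.
by have := ceilB1_lt (vtime t l / tg); rewrite intrB.
Qed.

(** The last parallel edge carries exactly what the edges of time [tg] leave over; it exists because
    the multiplicity is positive on G_v. *)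
Lemma sum_edge_time l :
  \sum_(j < mult t tg l) edge_time (Tagged (fun l => 'I_(mult t tg l)) j) =
  if in_Gv t l then vtime t l else 0.
Proof.
rewrite /edge_time /=.
case: ifP => lG; last first.
  have m0 : mult t tg l = 0%N by rewrite /mult lG.
  by move: m0; case: (mult t tg l) => // _; rewrite big_ord0.
have [] := mult_bound lG; case: (mult t tg l) => // n _ _.
rewrite big_ord_recr /= eqxx (eq_bigr (fun=> tg)); last first.
  by move=> i _; rewrite eqSS ltn_eqF.
by rewrite sumr_const card_ord -[tg *+ n]mulr_natl addrC subrK.
Qed.

(** Each edge of G_m has one color, so it is scheduled exactly once, and the edges over [e] carry
    [t e] in total. *)
Lemma color_schedule_time kappa (color : Gm_edge t tg -> 'I_kappa) e :
  timed_link_time (color_schedule color) e = scaling tg kappa * t e.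
Proof.
rewrite /timed_link_time /color_schedule big_map big_enum /=.
rewrite (exchange_big_dep (fun m : Gm_edge t tg => (tag m).1 == e)) /=; last first.
  by move=> i m _ /andP[].
rewrite (eq_bigr (fun m => scaling tg kappa * edge_time m)); last first.
  move=> m me; rewrite (big_pred1 (color m)) // => i.
  by rewrite me andbT eq_sym.
rewrite -mulr_sumr; congr (_ * _).
rewrite -(sum_vtime e) [RHS]big_mkcond /=.
under [RHS]eq_bigr => o _ do rewrite -sum_edge_time.
rewrite (eq_bigl (fun m : Gm_edge t tg => ((tag m).1 == e) && predT (tagged m)));
  last by move=> m; rewrite andbT.
rewrite -(sig_big_dep (fun l => l.1 == e) (fun l (j : 'I_(mult t tg l)) => true)
  (fun l j => edge_time (Tagged (fun l => 'I_(mult t tg l)) j))) /=.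
rewrite (reindex_onto (pair e) snd) /=; last by case=> f o /= /eqP ->.
by apply: eq_bigl => o; rewrite !eqxx.
Qed.

(** * Maximum degree of G_m *)

Lemma Gm_degreeE a : Gm_degree t tg a = (\sum_(l | vincident l a) mult t tg l)%N.
Proof.
rewrite /Gm_degree -sum1dep_card.
rewrite (eq_bigl (fun m : Gm_edge t tg => vincident (tag m) a && predT (tagged m)));
  last by move=> m; rewrite andbT.
rewrite -(sig_big_dep (fun l => vincident l a) (fun l (j : 'I_(mult t tg l)) => true)
  (fun l j => 1%N)) /=.
by apply: eq_bigr => l _; rewrite sum1_card card_ord.
Qed.

Hypothesis gateway_time : \sum_(e | incident e None) t e <= (nRF N)%:R.
Hypothesis mmBS_time : forall v, \sum_(e | incident e (Some v)) t e <= 1.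

(** A copy of the eNB gets a fraction 1/R of a total of at most R; at an mmBS the copies of each
    link recombine to its full time. *)
Lemma vincident_time a : \sum_(l | vincident l a && in_Gv t l) vtime t l <= 1.
Proof.
case: a => [k|v].
  rewrite (reindex_onto (fun e => (e, Some k)) fst) /=; last first.
    by case=> e o /= /andP[/eqP ->].
  have R0 : (0 : R) < (nRF N)%:R by rewrite ltr0n nRF_gt0.
  rewrite -(ler_pM2r R0) mul1r mulr_suml; apply: le_trans gateway_time.
  rewrite [leRHS]big_mkcond [leLHS]big_mkcond; apply: ler_sum => e _.
  rewrite !eqxx andbT /in_Gv /= incident_None /leaves /=.
  case: (src e == None); rewrite ?andbF //= andbT /vtime /= divfK ?(gt_eqF R0) //.
  by case: ifP => // _; exact: t_ge0.
apply: le_trans (mmBS_time v); rewrite le_eqVlt; apply/orP; left; apply/eqP.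
under [RHS]eq_bigr => e _ do rewrite -sum_vtime.
by rewrite pair_big_dep /=; apply: eq_big => [[]|[]].
Qed.

Hypothesis acyclic : forall p, directed_cycle p ->
  ~ (forall e, e \in p -> 0 < t e).

Lemma in_Gv_gt0 l : in_Gv t l -> 0 < t l.1.
Proof. by case/andP => tl _; rewrite lt_def tl t_ge0. Qed.

(** Two antiparallel links would be a directed cycle of length two. Excluding them keeps G_v free of
    parallel edges once orientation is forgotten. *)
Lemma no_two_cycle e e' : 0 < t e -> 0 < t e' ->
  src e = Some (dst e') -> src e' <> Some (dst e).
Proof.
move=> te te' se se'; apply: (acyclic (p := [:: e; e'])); last first.
  by move=> f; rewrite !inE => /orP[] /eqP ->.
rewrite /directed_cycle /= /enters se se' !eqxx !inE /= andbT.
by have := link_irrefl e; rewrite se (inj_eq Some_inj) eq_sym.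
Qed.

(* The last branch is a junk value: a link of the eNB has [l.2 = Some k]. *)
Definition vtail l : vnode N :=
  match l.2, src l.1 with
  | Some k, _ => inl k
  | None, Some u => inr u
  | None, None => inr (dst l.1)
  end.

Definition vhead l : vnode N := inr (dst l.1).

(** A case analysis that fixes source, copy index and tail together, so the junk branch of [vtail]
    never arises. *)
Variant in_Gv_spec l : option (mmBS N) -> option 'I_(nRF N) -> vnode N -> Type :=
| InGvGateway k : in_Gv_spec l None (Some k) (inl k)
| InGvInner u : in_Gv_spec l (Some u) None (inr u).

Lemma in_GvP l : in_Gv t l -> in_Gv_spec l (src l.1) l.2 (vtail l).
Proof.
rewrite /in_Gv /vtail /leaves => /andP[_].
by case: (src l.1) (l.2) => [u|] [k|] // _; constructor.
Qed.

Lemma vincidentE l a : in_Gv t l ->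
  vincident l a = (vhead l == a) || (vtail l == a).
Proof.
rewrite /vincident /vhead /incident /enters /leaves.
by case/in_GvP => [k|u]; case: a => [k'|v] //=; rewrite ?orbF.
Qed.

Lemma vtail_neq_vhead l : in_Gv t l -> vtail l != vhead l.
Proof.
move=> lG; have := link_irrefl l.1.
by case: (in_GvP lG) => [k|u] //.
Qed.

Lemma vends_inj l l' : in_Gv t l -> in_Gv t l' ->
  vtail l = vtail l' -> vhead l = vhead l' -> l = l'.
Proof.
move=> lG lG' + [dE].
have srcE : src l.1 = src l'.1 -> l.1 = l'.1.
  by move=> sE; apply: (@link_inj _ N); rewrite sE dE.
suff : vtail l = vtail l' -> l.1 = l'.1 /\ l.2 = l'.2.
  by case: (l) (l') => [e o] [e' o'] /= /[apply] -[-> ->].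
move: srcE.
by case: (in_GvP lG) (in_GvP lG') => [k|u] [k'|u'] // h [E]; rewrite ?E in h *;
  rewrite h.
Qed.

Definition neighbor a l : vnode N := if vhead l == a then vtail l else vhead l.

Lemma neighbor_inj a :
  {in [pred l | vincident l a && in_Gv t l] &, injective (neighbor a)}.
Proof.
move=> l l' /andP[la lG] /andP[la' lG']; move: la la'.
rewrite !vincidentE // /neighbor.
(* Opposite orientations: a copy of the eNB is never a head, so both links are inner and
   [no_two_cycle] applies. Equal orientations are left to [vends_inj]. *)
have no2 : vtail l = vhead l' -> vtail l' = vhead l -> l = l'.
  move=> h h'.
  have := no_two_cycle (in_Gv_gt0 lG) (in_Gv_gt0 lG').
  move: h h'; rewrite /vhead.
  by case: (in_GvP lG) (in_GvP lG') => [k|u] [k'|u'] // [->] [->] /(_ erefl).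
case: eqP => [h|h] /= hl; case: eqP => [h'|h'] /= hl' E.
- by apply: vends_inj; rewrite // h h'.
- by apply: no2; rewrite // (eqP hl') h.
- by apply: no2; rewrite // (eqP hl) h'.
- by apply: vends_inj; rewrite // (eqP hl) (eqP hl').
Qed.

(** [neighbor a] injects these links into the W + R - 1 nodes other than [a]. *)
Lemma card_vincident a :
  (#|[pred l | vincident l a && in_Gv t l]| <= (nRF N + #|mmBS N|).-1)%N.
Proof.
rewrite -(card_in_image (@neighbor_inj a)).
rewrite -[X in (_ <= (X + _).-1)%N]card_ord -card_sum -(cardC1 a).
apply: subset_leq_card; apply/subsetP => b /imageP[l /andP[la lG] ->].
rewrite !inE /neighbor; have [<-|//] := eqVneq (vhead l) a.
exact: vtail_neq_vhead.
Qed.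

(** Unrounded, the multiplicities at [a] sum to at most [1 / tg]; rounding up adds at most 1 per
    link. *)
Lemma Gm_degree_bound a :
  (Gm_degree t tg a)%:R <= tg^-1 + (nRF N + #|mmBS N|).-1%:R.
Proof.
rewrite Gm_degreeE (bigID (in_Gv t)) /= [X in (_ + X)%N]big1 ?addn0; last first.
  by move=> l /andP[_ /negbTE lG]; rewrite /mult lG.
rewrite natr_sum.
apply: (@le_trans _ _ (\sum_(l | vincident l a && in_Gv t l) (vtime t l / tg + 1))).
  by apply: ler_sum => l /andP[_ /mult_bound[_ /ltW]].
rewrite big_split /= -mulr_suml sumr_const lerD //.
  by rewrite -[leRHS]mul1r ler_wpM2r ?invr_ge0 ?(ltW tg_gt0) ?vincident_time.
by rewrite ler_nat card_vincident.
Qed.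

Lemma Gm_max_degree_bound :
  (Gm_max_degree t tg)%:R <= tg^-1 + (nRF N + #|mmBS N|).-1%:R.
Proof.
rewrite /Gm_max_degree; elim/big_ind: _ => [|x y hx hy|a _].
- by rewrite addr_ge0 ?invr_ge0 ?(ltW tg_gt0).
- by rewrite /maxn; case: ifP.
- exact: Gm_degree_bound.
Qed.

(** * The scaling factor *)

Lemma scaling_bound kappa :
  (kappa <= 3 * uphalf (Gm_max_degree t tg))%N ->
  2 / (3 * ((#|mmBS N| + nRF N + 1)%:R * tg + 1)) < scaling tg kappa.
Proof.
move=> hk; have hD := Gm_max_degree_bound.
have hk2 : (2 * kappa <= 3 * (Gm_max_degree t tg).+1)%N by lia.
have {}hk2 : 2 * kappa%:R <= 3 * ((Gm_max_degree t tg)%:R + 1) :> R.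
  by rewrite natr1 -!natrM ler_nat.
have Rp := nRF_gt0.
have predE : (nRF N + #|mmBS N|).-1%:R + 1 = (#|mmBS N| + nRF N)%:R :> R.
  by rewrite natr1; congr (_%:R); lia.
have [c cE] : exists c : R, c = (#|mmBS N| + nRF N)%:R by eexists.
have c0 : 0 <= c by rewrite cE.
rewrite -cE in predE; rewrite natrD -cE.
have ctg : 0 <= c * tg by rewrite mulr_ge0 // ltW.
have tg0 := tg_gt0.
have D0 : 0 < 3 * ((c + 1) * tg + 1) by lra.
(* The 1 lost in rounding half the degree up turns W + R - 1 into [c = W + R]. *)
have kb : 2 * (kappa%:R * tg) <= 3 * (1 + c * tg).
  have h : 2 * kappa%:R <= 3 * (tg^-1 + c) by lra.
  have := ler_wpM2r (ltW tg_gt0) h.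
  rewrite -mulrA [leRHS](_ : _ = 3 * (1 + c * tg)) //.
  by field; rewrite gt_eqF.
(* Strictness comes from the denominator having [c + 1] where [kb] has [c]. *)
rewrite ltr_pdivrMr // /scaling; case: ifP => [k1|_]; last by lra.
have k0 : 0 < kappa%:R * tg by lra.
by rewrite ltr_pdivlMl //; lra.
Qed.

End Coloring.

(** * Assembling the throughput bound *)

Lemma throughput_scale (R : realType) (N : network R) (t u : link N -> R)
    (c : R) v : (forall e, u e = c * t e) -> throughput u v = c * throughput t v.
Proof.
move=> uE; rewrite /throughput mulrBr !mulr_sumr.
by congr (_ - _); apply: eq_bigr => e _; rewrite uE mulrCA.
Qed.

Theorem mainTheorem3 (R : realType) (N : network R) (tg : R)
    (htg : 0 < tg <= 1)
    (theta_star : R) (hstar : MTFS_optimum N theta_star)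
    (hstar_gt0 : 0 < theta_star)
    (S : timed_schedule N) (hS : EC_output tg S)
    (theta' : R) (htheta' : is_min_throughput (timed_link_time S) theta') :
  theta' > 2 / (3 * ((#|mmBS N| + nRF N + 1)%:R * tg + 1)) * theta_star.
Proof.
have {htg} /andP[tg_gt0 _] := htg.
have [[S0 S0f [_ S0_ge]] _] := hstar.
have [t0 [t [kappa [color [[theta [_ theta_max] [[t' lp] _]] elim _ hk ES]]]]] := hS.
have le_theta : theta_star <= theta.
  apply: theta_max; exists (link_time S0), (slot_time S0).
  exact: feasible_lp_feasible.
case: lp => t0_ge0 t'_ge0 t0_thr _ _ t0_gw t0_bs.
have [t_ge0 t_le thrE acyclic] := eliminate_cycles_spec elim t0_ge0.
have sum_le (P : pred (link N)) : \sum_(e | P e) t e <= \sum_(e | P e) t0 e.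
  by apply: ler_sum.
have scal : 2 / (3 * ((#|mmBS N| + nRF N + 1)%:R * tg + 1)) < scaling tg kappa.
  apply: scaling_bound t_ge0 tg_gt0 _ _ acyclic _ hk.
    (* The sum subtracted in (c) is nonnegative, so (c) bounds the eNB time by R. *)
    apply: le_trans (sum_le _) (le_trans t0_gw _); rewrite gerBl big_nat_cond.
    apply: sumr_ge0 => k; rewrite andbT => kn.
    by rewrite mulr_ge0 ?le_max ?lexx ?t'_ge0.
  by move=> v; apply: le_trans (sum_le _) (t0_bs v).
(* It suffices to bound the throughput at a node [v] attaining the minimum. *)
have [[v <-] _] := htheta'.
rewrite ES (throughput_scale v (color_schedule_time t_ge0 tg_gt0 color)) thrE.
apply: lt_le_trans (_ : scaling tg kappa * theta_star <= _).
  by rewrite ltr_pM2r.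
have D_ge0 : 0 <= (#|mmBS N| + nRF N + 1)%:R * tg + 1.
  by rewrite addr_ge0 // mulr_ge0 // ltW.
rewrite ler_wpM2l ?(le_trans le_theta) //.
by apply: ltW (le_lt_trans _ scal); rewrite divr_ge0 ?mulr_ge0.
Qed.
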